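(* Let $(\Omega,\mathcal F,\mathbb P)$ be an atomless probability space, let $\mathcal X$ be a convex cone of random variables on it, and let $\rho:\mathcal X\to(-\infty,\infty]$ be a risk measure on $\mathcal X$ (that is, any mapping from $\mathcal X$ to $(-\infty,\infty]$). The following are equivalent: (i) $\rho$ satisfies [LI] and [CA]. (ii) $\rho$ satisfies [$p$-CA] for some $p\in(0,1)$.
   Context: $X\overset{d}{=}Y$ means equality in law. All random variables in the properties below are tacitly assumed to be in $\mathcal X$. A tail event of a random variable $X$ is an event $A\in\mathcal F$ with $0<\mathbb P(A)<1$ such that $X(\omega)\ge X(\omega')$ for a.s. all $\omega\in A$ and $\omega'\in A^c$, where $A^c$ is the complement of $A$. For $p\in(0,1)$, a $p$-tail event of $X$ is a tail event of $X$ with probability $1-p$. A random vector is $p$-concentrated if its components share a common $p$-tail event. [LI] (law invariance): $\rho(X)=\rho(Y)$ whenever $X\overset{d}{=}Y$. [CA] (concentration aversion): there exists an event $A\in\mathcal F$ with $\mathbb P(A)\in(0,1)$ such that $\rho(X+Y)\le\rho(X'+Y')$ whenever $X\overset{d}{=}X'$, $Y\overset{d}{=}Y'$, and $X'$ and $Y'$ share the tail event $A$ (i.e. $A$ is a tail event of both $X'$ and $Y'$). [$p$-CA] ($p$-concentration aversion, for $p\in(0,1)$): $\rho(X+Y)\le\rho(X'+Y')$ for all $(X,Y)$ and all $p$-concentrated $(X',Y')$ satisfying $X\overset{d}{=}X'$ and $Y\overset{d}{=}Y'$.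
   Formalization: The convex cone 𝒳 is additionally assumed closed under equality in law (X in 𝒳 and Y equal in law to X imply Y in 𝒳); for arbitrary convex cones (i) does not imply (ii), e.g. the cone generated by U and 1−U on [0,1]. *)

(* Defs.v *)
From HB Require Import structures.
From mathcomp Require Import all_boot all_order all_algebra.
From mathcomp Require Import all_classical all_reals all_analysis.
From mathcomp Require Import measurable_realfun.

Set Implicit Arguments.
Unset Strict Implicit.
Unset Printing Implicit Defensive.

Import Order.TTheory GRing.Theory Num.Theory.
Import numFieldNormedType.Exports.

Local Open Scope classical_set_scope.
Local Open Scope ring_scope.

Section concentration_aversion.
Context {d : measure_display} {T : measurableType d} {R : realType}.
Variable P : probability T R.
Implicit Types (X Y : {RV P >-> R}) (A : set T) (p : R).
Implicit Types (calX : set {RV P >-> R}) (rho : {RV P >-> R} -> \bar R).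

Definition atomless : Prop :=
  forall A, measurable A -> (0 < P A)%E ->
    exists B, [/\ measurable B, B `<=` A, (0 < P B)%E & (P B < P A)%E].

(* The equality [distribution P X = distribution P Y] would be too strong: it
   also compares the junk values of [P] on nonmeasurable sets. *)
Definition eq_law X Y : Prop :=
  forall B : set R, measurable B -> distribution P X B = distribution P Y B.

(* The cone need not contain 0. *)
Definition convex_cone calX : Prop :=
  forall (a b : R) X Y, 0 < a -> 0 < b -> calX X -> calX Y ->
    calX (a \o* X + b \o* Y).

(* Closure of the domain under equality in law. On a cone without it, law
   invariance and concentration aversion need not imply p-concentration
   aversion: on [0, 1] with U w = w, take calX = {a U + b (1 - U) | a, b >= 0}
   and rho Z = 1 if Z = 1, rho Z = 0 otherwise. Only constants of calX have
   A = ]1/4, 3/4[ as a tail event, so concentration aversion holds for A;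
   but rho (U + (1 - U)) > rho (U + U), where U and 1 - U have the same law
   and (U, U) is p-concentrated for every p. *)
Definition law_closed calX : Prop :=
  forall X Y, eq_law X Y -> calX X -> calX Y.

(* A map calX -> (-oo, +oo] is given by a total map, only whose values on calX
   are ever constrained or used. *)
Definition risk_measure calX rho : Prop :=
  forall X, calX X -> rho X != -oo%E.

(* "X w >= X w' for a.s. all w in A and w' in A^c": off one null set. *)
Definition tail_event X A : Prop :=
  [/\ measurable A, (0 < P A < 1)%E &
    exists2 N, P.-negligible N &
      forall w w', (A `\` N) w -> (~` A `\` N) w' -> X w' <= X w].

Definition p_tail_event p X A : Prop :=
  tail_event X A /\ P A = (1 - p)%:E.

Definition p_concentrated p X Y : Prop :=
  exists A, p_tail_event p X A /\ p_tail_event p Y A.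

Definition law_invariance calX rho : Prop :=
  forall X Y, calX X -> calX Y -> eq_law X Y -> rho X = rho Y.

Definition concentration_aversion calX rho : Prop :=
  exists A, [/\ measurable A, (0 < P A < 1)%E &
    forall X Y X' Y', calX X -> calX Y -> calX X' -> calX Y' ->
      eq_law X X' -> eq_law Y Y' -> tail_event X' A -> tail_event Y' A ->
      (rho (X + Y)%R <= rho (X' + Y')%R)%E].

Definition p_concentration_aversion p calX rho : Prop :=
  forall X Y X' Y', calX X -> calX Y -> calX X' -> calX Y' ->
    p_concentrated p X' Y' -> eq_law X X' -> eq_law Y Y' ->
    (rho (X + Y)%R <= rho (X' + Y')%R)%E.

End concentration_aversion.

(* Main.v *)
Require Import Defs.
From HB Require Import structures.
From mathcomp Require Import all_boot all_order all_algebra.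
From mathcomp Require Import all_classical all_reals all_analysis.
From mathcomp Require Import measurable_realfun.
From mathcomp Require Import lra.

Set Implicit Arguments.
Unset Strict Implicit.
Unset Printing Implicit Defensive.

Import Order.TTheory GRing.Theory Num.Theory.
Import numFieldNormedType.Exports.

Local Open Scope classical_set_scope.
Local Open Scope ring_scope.

(* Any partition of B into atoms can be copied, mass by mass, onto an event A
   of the same probability, because atomless measures take all intermediate
   values. Copying along the binary tree generated by B and the rational cuts
   of X' and Y' yields (X'', Y'') with the same joint law relative to A as
   (X', Y') relative to B; law closure puts X'' and Y'' in the cone. So the
   single tail event A of concentration aversion stands for all tail events of
   probability P A = 1 - p. Conversely, Z = Z/2 + Z/2, and (Z/2, Z/2) is
   p-concentrated since every Z has a p-tail event: p-concentration aversion
   applied in both directions gives law invariance. *)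

(** * Intermediate values of atomless probabilities *)

Section atomless_range.
Context (d : measure_display) (T : measurableType d) (R : realType).
Variable P : probability T R.
Implicit Types (A B C D : set T) (v : R).

Lemma probability_fineK A : measurable A -> P A = (fine (P A))%:E.
Proof. by move=> mA; rewrite fineK// fin_num_measure. Qed.

Lemma fine_probability_ge0 A : 0 <= fine (P A).
Proof. exact: fine_ge0. Qed.

Lemma fine_probability_le1 A : measurable A -> fine (P A) <= 1.
Proof. by move=> mA; rewrite -lee_fin -probability_fineK// probability_le1. Qed.

Lemma fine_probabilityS A B : measurable A -> measurable B -> A `<=` B ->
  fine (P A) <= fine (P B).
Proof.
move=> mA mB AB; rewrite -lee_fin -!probability_fineK//.
by apply: le_measure; rewrite ?inE.
Qed.

Lemma fine_probabilityD A B : measurable A -> measurable B -> B `<=` A ->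
  fine (P (A `\` B)) = fine (P A) - fine (P B).
Proof.
move=> mA mB BA; apply: EFin_inj; rewrite EFinB -!probability_fineK//.
- rewrite measureD//; first by rewrite setIidr.
  by rewrite -ge0_fin_numE ?fin_num_measure.
- exact: measurableD.
Qed.

Lemma fine_probabilityU A B : measurable A -> measurable B ->
  [disjoint A & B] ->
  fine (P (A `|` B)) = fine (P A) + fine (P B).
Proof.
move=> mA mB /disj_setPS AB; apply: EFin_inj; rewrite EFinD -!probability_fineK//.
- by rewrite measureU//; rewrite -subset0.
- exact: measurableU.
Qed.

(** Atomlessness splits a nonnull event into two nonnull pieces, and the lighter one has at most
    half the mass. Repeating this [N] times leaves mass at most [2 ^- N]. *)
Lemma atomless_small A e : atomless P -> measurable A -> (0 < P A)%E -> 0 < e ->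
  exists B, [/\ measurable B, B `<=` A, 0 < fine (P B) & fine (P B) < e].
Proof.
move=> atl mA A0 e0.
have [N Ne] : exists N : nat, e^-1 < 2 ^+ N.
  exists (Num.truncn e^-1).+1.
  rewrite (lt_le_trans (truncnS_gt _))// -natrX ler_nat.
  exact/ltnW/ltn_expl.
suff: exists B, [/\ measurable B, B `<=` A, 0 < fine (P B)
    & fine (P B) * 2 ^+ N <= 1].
  move=> [B [mB BA B0 BN]]; exists B; split => //.
  rewrite -(ltr_pM2r (x := 2 ^+ N)) ?exprn_gt0// (le_lt_trans BN)//.
  by rewrite -(ltr_pM2l (x := e^-1)) ?invr_gt0// mulr1 mulrA mulVf ?gt_eqF// mul1r.
elim: {Ne}N => [|N [B [mB BA B0 BN]]].
  exists A; split => //; first by rewrite -lte_fin -probability_fineK.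
  by rewrite expr0 mulr1 fine_probability_le1.
have [|C [mC CB C0 CltB]] := atl B mB.
  by rewrite probability_fineK// lte_fin.
have PC0 : 0 < fine (P C) by rewrite -lte_fin -probability_fineK.
have PCB : fine (P C) < fine (P B).
  by rewrite -lte_fin -!probability_fineK.
have PBC := fine_probabilityD mB mC CB.
have [CBC|BCC] := leP (fine (P C)) (fine (P (B `\` C))).
  exists C; split => //; first exact: subset_trans BA.
  rewrite exprS mulrA (le_trans _ BN)// ler_wpM2r// ?exprn_ge0//.
  by rewrite PBC in CBC; lra.
exists (B `\` C); split => //.
- exact: measurableD.
- by move=> x [/BA].
- by rewrite PBC subr_gt0.
- rewrite exprS mulrA (le_trans _ BN)// ler_wpM2r// ?exprn_ge0//.
  by rewrite PBC in BCC *; lra.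
Qed.

(* Greedy exhaustion: at each step add an admissible piece of at least half the
   largest admissible mass; a missing mass would leave an admissible piece of
   fixed positive measure at every step. *)
Lemma atomless_range C v : atomless P -> measurable C -> 0 <= v ->
  (v%:E <= P C)%E ->
  exists D, [/\ measurable D, D `<=` C & P D = v%:E].
Proof.
move=> atl mC v0 vC.
pose adm D B := [/\ measurable B, B `<=` C `\` D & fine (P D) + fine (P B) <= v].
pose good D := [/\ measurable D, D `<=` C & fine (P D) <= v].
(* Stated for every [D], with [set0] as default outside [good], so that [choice] yields a total
   function. *)
have step D : exists B, good D ->
    adm D B /\ forall B', adm D B' -> fine (P B') <= 2 * fine (P B).
  have [gD|] := pselect (good D); last by exists set0.
  case: (gD) => mD DC Dv.
  pose S := [set fine (P B) | B in adm D].
  have S0 : S 0.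
    exists set0; last by rewrite measure0.
    by split=> //; rewrite measure0/= addr0.
  have supS : has_sup S.
    by split; [exists 0 | exists 1 => _ [B [mB _ _] <-]; exact: fine_probability_le1].
  have [S_gt0|S_le0] := ltP 0 (sup S).
    (* An admissible piece within [sup S / 2] of the supremum has mass above half of it. *)
    have [_ [B aB <-] lB] := sup_adherent (divr_gt0 S_gt0 (ltr0n _ 2)) supS.
    exists B => _; split => // B' aB'.
    have : fine (P B') <= sup S by apply: ub_le_sup; [exact: supS.2|exists B'].
    by rewrite -/S in lB *; lra.
  exists set0 => _; split.
    by split=> //; rewrite measure0/= addr0.
  move=> B' aB'; rewrite measure0 mulr0 (le_trans _ S_le0)//.
  by apply: ub_le_sup; [exact: supS.2|exists B'].
have [f fP] := choice step.
pose F := fix F n := if n is n'.+1 then F n' `|` f (F n') else set0.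
have disjF D B : adm D B -> [disjoint D & B].
  by move=> [_ BD _]; apply/disj_setPS => x [Dx /BD[]].
have gF n : good (F n).
  elim: n => [|n gn]; first by split => //=; rewrite measure0.
  have [aB _] := fP _ gn; have dB := disjF _ _ aB.
  case: gn aB => mF FC Fv [mB BC Bv]; split => /=.
  - exact: measurableU.
  - by move=> x [/FC//|/BC[]].
  - by rewrite fine_probabilityU.
have mF n : measurable (F n) by case: (gF n).
have mUF : measurable (\bigcup_n F n) by exact: bigcup_measurable.
have PFS n : fine (P (F n.+1)) = fine (P (F n)) + fine (P (f (F n))).
  have [aB _] := fP _ (gF n); have dB := disjF _ _ aB.
  by rewrite /= fine_probabilityU//; case: aB.
have ndF : {homo F : n m / (n <= m)%N >-> (n <= m)%O}.
  by apply/nondecreasing_seqP => n; apply/subsetPset => x; left.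
have UFC : \bigcup_n F n `<=` C by move=> x [n _]; case: (gF n) => _ + _; exact.
have UFv : fine (P (\bigcup_n F n)) <= v.
  rewrite -lee_fin -probability_fineK//.
  have cF := nondecreasing_cvg_mu (mu := P) mF mUF ndF.
  rewrite -(cvg_lim _ cF)//; apply: lime_le.
    by apply/cvg_ex; eexists; exact: cF.
  apply: nearW => n /=; rewrite probability_fineK// lee_fin.
  by case: (gF n).
exists (\bigcup_n F n); split => //.
rewrite probability_fineK//; congr EFin; apply/eqP; rewrite eq_le UFv/= leNgt.
apply/negP => UFltv.
have mrest : measurable (C `\` \bigcup_n F n) by exact: measurableD.
(* [B] avoids every [F n] and fits into the mass still missing, so it is admissible at every stage.
   Each step thus adds at least [P B / 2], which exceeds total mass 1 after more than [2 / P B]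
   steps. *)
have [||B [mB BC B0 Bv]] := @atomless_small _ (v - fine (P (\bigcup_n F n))) atl mrest.
- rewrite probability_fineK// lte_fin fine_probabilityD// subr_gt0.
  by rewrite (lt_le_trans UFltv)// -lee_fin -probability_fineK.
- by rewrite subr_gt0.
have aB n : adm (F n) B.
  split=> //.
    by move=> x /BC[Cx nUx]; split => // Fx; apply: nUx; exists n.
  have : fine (P (F n)) <= fine (P (\bigcup_n F n)).
    by apply: fine_probabilityS => //; exact: bigcup_sup.
  by move: Bv; lra.
have lF n : n%:R * fine (P B) <= 2 * fine (P (F n)).
  elim: n => [|n IHn]; first by rewrite mul0r /= measure0 mulr0.
  have := (fP _ (gF n)).2 _ (aB n).
  by rewrite PFS -natr1 mulrDl mul1r; lra.
have := lF (Num.truncn (2 / fine (P B))).+1.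
apply/negP; rewrite -ltNge; apply: (@le_lt_trans _ _ 2).
  by have := fine_probability_le1 (mF (Num.truncn (2 / fine (P B))).+1); lra.
by rewrite -ltr_pdivrMr// truncnS_gt.
Qed.

End atomless_range.

(** * Quantiles and existence of tail events *)

Section tail_events.
Context (d : measure_display) (T : measurableType d) (R : realType).
Variable P : probability T R.

(** The witness is the left quantile, the infimum of the points where the cdf reaches [p]. Right
    continuity of the cdf gives the upper inequality, continuity of [P] from below along
    [Z <= t - 1/(n+1)] the lower one. *)
Lemma quantile_exists (Z : {RV P >-> R}) (p : R) : 0 < p < 1 ->
  exists t, (P [set w | (Z w < t)%R] <= p%:E <= P [set w | (Z w <= t)%R])%E.
Proof.
move=> /andP[p0 p1].
have cdfE x : cdf Z x = P [set w | (Z w <= x)%R] by [].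
have p1E : (p%:E < 1)%E by rewrite lte_fin.
(* The limits 1 and 0 of the cdf at both infinities make [S] nonempty and bounded below. *)
have p0E : (0 < p%:E)%E by rewrite lte_fin.
have [M [Mr MP]] := cvg_cdfy1 Z (open_ereal_gt' p1E).
have [m [mr mP]] := cvg_cdfNy0 Z (open_ereal_lt' p0E).
pose S := [set x | (p%:E <= cdf Z x)%E].
have SM : S (M + 1) by apply/ltW/MP; rewrite ltrDl.
have lbS : lbound S m.
  move=> x Sx; rewrite leNgt; apply/negP => /mP.
  by apply/negP; rewrite -leNgt.
have infS : has_inf S by split; [exists (M + 1)|exists m].
exists (inf S); apply/andP; split; last first.
  rewrite -cdfE leNgt; apply/negP => ltp.
  have [e /= e0 eP] := cdf_right_continuous (X := Z) (open_ereal_lt' ltp).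
  (* Such an [x] has cdf at least [p] by membership in [S], yet below [p] by right continuity at
     [inf S]. *)
  have [x Sx xe] := inf_adherent e0 infS.
  have : inf S <= x by apply: ge_inf Sx; exact: infS.2.
  rewrite le_eqVlt => /orP[/eqP ix|ix].
    by move: Sx; rewrite /S/= -ix leNgt ltp.
  have : (cdf Z x < p%:E)%E.
    by apply: eP => //=; rewrite ltr0_norm ?subr_lt0// opprB ltrBlDl.
  by apply/negP; rewrite -leNgt.
pose F n := [set w | (Z w <= inf S - n.+1%:R^-1)%R].
have FU : [set w | (Z w < inf S)%R] = \bigcup_n F n.
  apply/seteqP; split => w /=.
    rewrite -subr_gt0 => Zw; exists (Num.truncn (inf S - Z w)^-1) => //.
    rewrite /F/= lerBrDr -lerBrDl.
    rewrite -[leRHS]invrK lef_pV2 ?posrE ?invr_gt0 ?ltr0n//.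
    by rewrite ltW// truncnS_gt.
  by move=> [n _]; rewrite /F/= => /le_lt_trans; apply; rewrite gtrBl invr_gt0.
have mF n : measurable (F n).
  rewrite [F n](_ : _ = Z @^-1` `]-oo, (inf S - n.+1%:R^-1)%R]).
    exact: measurable_funPTI.
  by apply/seteqP; split => w /=; rewrite in_itv.
have mU : measurable (\bigcup_n F n) by exact: bigcup_measurable.
have ndF : {homo F : n m / (n <= m)%N >-> (n <= m)%O}.
  move=> n k nk; apply/subsetPset => w; rewrite /F/= => /le_trans; apply.
  by rewrite lerB// lef_pV2 ?posrE ?ltr0n// ler_nat.
have cF := nondecreasing_cvg_mu (mu := P) mF mU ndF.
rewrite FU -(cvg_lim _ cF)//; apply: lime_le.
  by apply/cvg_ex; eexists; exact: cF.
apply: nearW => n /=; rewrite leNgt -cdfE; apply/negP => /ltW Sn.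
have : inf S <= inf S - n.+1%:R^-1 by apply: ge_inf Sn; exact: infS.2.
by apply/negP; rewrite -ltNge gtrBl invr_gt0.
Qed.

(** The event consists of [Z > t], for a [p]-quantile [t], and a part of the level set [Z = t], cut
    out by atomlessness to bring the total mass to [1 - p]. *)
Lemma p_tail_event_exists (Z : {RV P >-> R}) (p : R) : atomless P ->
  0 < p < 1 -> exists A, p_tail_event p Z A.
Proof.
move=> atl p01; have [t /andP[ltp lep]] := quantile_exists Z p01.
have /andP[p0 p1] := p01.
have mpre (B : set R) : measurable B -> measurable (Z @^-1` B).
  by move=> mB; exact: measurable_funPTI.
pose L := [set w | (Z w < t)%R]; pose Q := [set w | Z w = t].
pose U := ~` (L `|` Q).
have mL : measurable L by exact: (mpre `]-oo, t[%classic).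
have mQ : measurable Q by exact: (mpre [set t]).
have mLQ : measurable (L `|` Q) by exact: measurableU.
have mU : measurable U by exact: measurableC.
have {}ltp : fine (P L) <= p by rewrite -lee_fin -probability_fineK.
have LQ : [disjoint L & Q].
  by apply/disj_setPS => w []; rewrite /L/Q/= => /[swap] ->; rewrite ltxx.
have LQU : [disjoint L `|` Q & U] by apply/disj_setPS => w [].
have LQE : L `|` Q = [set w | (Z w <= t)%R].
  apply/seteqP; split => w; rewrite /L/Q/=.
    by case => [/ltW|->].
  by rewrite le_eqVlt => /orP[/eqP|]; [right|left].
have LQUT : (L `|` Q) `|` U = setT by exact: setUCr.
have {}lep : p <= fine (P L) + fine (P Q).
  by rewrite -fine_probabilityU// -lee_fin -probability_fineK// LQE.
have PT : fine (P L) + fine (P Q) + fine (P U) = 1.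
  by rewrite -!fine_probabilityU// LQUT probability_setT.
(* The quantile inequalities say exactly that [1 - p - P U] lies between 0 and [P Q]. *)
have [||D [mD DQ PD]] := @atomless_range _ _ _ P Q (1 - p - fine (P U)) atl mQ.
- by move: ltp lep PT; lra.
- rewrite (probability_fineK _ mQ)// lee_fin; move: ltp lep PT; lra.
have DU : [disjoint D & U].
  apply/disj_setPS => w [/DQ Qw Uw]; move/disj_setPS : LQU; apply.
  by split; [right|exact: Uw].
have mA : measurable (D `|` U) by exact: measurableU.
have PA : P (D `|` U) = (1 - p)%:E.
  rewrite probability_fineK//; congr EFin; rewrite fine_probabilityU// PD/=.
  by lra.
exists (D `|` U); split => //; split => //.
  by rewrite PA !lte_fin; apply/andP; split; lra.
exists set0; first exact: negligible_set0.
move=> w w'; rewrite !setD0 => Aw nAw'.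
have : t <= Z w.
  case: Aw => [/DQ->//|/=]; rewrite /U LQE/= => /negP.
  by rewrite -ltNge => /ltW.
apply: le_trans.
have : (L `|` Q) w' by apply: contrapT => Uw'; apply: nAw'; right.
by rewrite LQE.
Qed.

End tail_events.

(** * Binary sequences and the cylinder sigma-algebra *)

(** The latest bit comes first, so that extending a prefix is a cons and shorter prefixes are
    suffixes of the list. *)
Fixpoint rev_prefix (b : nat -> bool) n : seq bool :=
  if n is n'.+1 then b n' :: rev_prefix b n' else [::].

Definition cylinder (s : seq bool) : set (nat -> bool) :=
  [set b | rev_prefix b (size s) = s].

Definition cylinders : set (set (nat -> bool)) :=
  [set C | C = set0 \/ exists s, C = cylinder s].

Local Notation binseq := (g_sigma_algebraType cylinders).

Lemma size_rev_prefix b n : size (rev_prefix b n) = n.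
Proof. by elim: n => //= n ->. Qed.

Lemma cylinder_consE b s x :
  cylinder (x :: s) b <-> cylinder s b /\ b (size s) = x.
Proof. by rewrite /cylinder/=; split => [[-> ->]|[-> ->]]. Qed.

Lemma rev_prefix_drop b m n : (m <= n)%N ->
  rev_prefix b m = drop (n - m) (rev_prefix b n).
Proof.
elim: n => [|n IHn]; first by rewrite leqn0 => /eqP ->.
rewrite leq_eqVlt => /orP[/eqP ->|mn]; first by rewrite subnn drop0.
by rewrite subSn//= IHn.
Qed.

(** Two cylinders are nested or disjoint, according to whether the longer word extends the shorter
    one; [set0] covers the disjoint case. *)
Lemma setI_closed_cylinders : setI_closed cylinders.
Proof.
have key s t : (size s <= size t)%N -> cylinders (cylinder s `&` cylinder t).
  move=> st; have [ts|ts] := pselect (drop (size t - size s) t = s).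
    right; exists t; apply/setIidr => b bt.
    by rewrite /cylinder/= (rev_prefix_drop b st) bt.
  left; rewrite -subset0 => b [bs bt]; apply: ts.
  by rewrite -{2}bt -rev_prefix_drop.
move=> A B [->|[s ->]] [->|[t ->]]; rewrite ?set0I ?setI0; try by left.
have [/key//|/ltnW/key] := leqP (size s) (size t).
by rewrite setIC.
Qed.

Lemma measurable_cylinder s : measurable (cylinder s : set binseq).
Proof. by apply: sub_sigma_algebra; right; exists s. Qed.

Lemma measurable_coordinate n :
  measurable ([set b : nat -> bool | b n] : set binseq).
Proof.
rewrite (_ : [set b : nat -> bool | b n] = \bigcup_(s : seq bool)
    (if size s == n then cylinder (true :: s) : set binseq else set0)).
  apply: countable_bigcupT_measurable => // s.
  by case: ifP => // _; exact: measurable_cylinder.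
apply/seteqP; split => [b bn|b [s _]] /=.
  exists (rev_prefix b n) => //; rewrite size_rev_prefix eqxx.
  by apply/cylinder_consE; rewrite /cylinder/= size_rev_prefix.
by case: eqP => // <- /cylinder_consE[].
Qed.

(** * Binary trees of events and the induced maps into binary sequences *)

Section binary_trees.
Context (d : measure_display) (T : measurableType d) (R : realType).
Variable P : probability T R.

Definition binary_tree (C : seq bool -> set T) := forall s,
  [/\ measurable (C s), C [::] = setT, C (true :: s) `<=` C s &
      C (false :: s) = C s `\` C (true :: s)].

Fixpoint branch (C : seq bool -> set T) w n : seq bool :=
  if n is n'.+1 then `[< C (true :: branch C w n') w >] :: branch C w n'
  else [::].

Definition address (C : seq bool -> set T) w : binseq :=
  fun n => `[< C (true :: branch C w n) w >].

Lemma rev_prefix_address C w n : rev_prefix (address C w) n = branch C w n.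
Proof. by elim: n => //= n ->. Qed.

(** The bits of [address C w] record the child chosen by [w] at each node, so following a word for
    [size s] steps means lying in the node [C s]. *)
Lemma preimage_address_cylinder C s : binary_tree C ->
  address C @^-1` cylinder s = C s.
Proof.
move=> treeC; elim: s => [|x s IHs].
  by case: (treeC [::]) => _ -> _ _; apply/seteqP; split.
have [_ _ sub diff] := treeC s.
apply/seteqP; split => w.
  move=> /cylinder_consE[ws]; have Csw : C s w by rewrite -IHs.
  rewrite /address -rev_prefix_address ws.
  by case: x => [/asboolP//|/asboolPn nC]; rewrite diff.
move=> Cw; have Csw : C s w by case: x Cw => [/sub//|]; rewrite diff => -[].
have ws : cylinder s (address C w) by move: Csw; rewrite -IHs.
apply/cylinder_consE; split => //.
rewrite /address -rev_prefix_address ws.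
by case: x Cw => [Cw|]; [apply/asboolP|rewrite diff => -[_ nC]; apply/asboolPn].
Qed.

Lemma branch_mem C w n : binary_tree C -> C (branch C w n) w.
Proof.
move=> treeC; rewrite -(preimage_address_cylinder _ treeC) /cylinder/=.
by rewrite -rev_prefix_address size_rev_prefix.
Qed.

Lemma measurable_address C : binary_tree C ->
  measurable_fun setT (address C : T -> binseq).
Proof.
move=> treeC; apply: (@measurability _ _ _ binseq setT (address C) cylinders
  erefl) => // _ [_ [->|[s ->]] <-].
  by rewrite preimage_set0 setI0.
by rewrite preimage_address_cylinder// setTI; case: (treeC s).
Qed.

(** Cylinders form a generating pi-system, and their masses under the two address laws are the
    masses of the nodes; uniqueness of measures does the rest. *)
Lemma address_law C E : binary_tree C -> binary_tree E ->
  (forall s, P (C s) = P (E s)) ->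
  forall S : set binseq, measurable S ->
    P (address C @^-1` S) = P (address E @^-1` S).
Proof.
move=> treeC treeE PCE S mS.
pose FC : {mfun T >-> binseq} :=
  HB.pack (address C)
    (isMeasurableFun.Build _ _ _ _ (address C) (measurable_address treeC)).
pose FE : {mfun T >-> binseq} :=
  HB.pack (address E)
    (isMeasurableFun.Build _ _ _ _ (address E) (measurable_address treeE)).
rewrite -[LHS]/(distribution P FC S) -[RHS]/(distribution P FE S).
apply: (@measure_unique _ R binseq cylinders (fun=> cylinder [::]) erefl _ _ _
  (distribution P FC) (distribution P FE)) => //.
- exact: setI_closed_cylinders.
- by move=> _; right; exists [::].
- by rewrite -subTset => b _; exists 0%N.
- move=> _ [->|[s ->]]; first by rewrite !measure0.
  rewrite /distribution/pushforward/=.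
  by have := PCE s; rewrite -!preimage_address_cylinder.
- move=> _; apply: le_lt_trans (ltry 1%R); apply: probability_le1.
  exact: measurable_cylinder.
Qed.

End binary_trees.

(** * Recovering a real number from its rational cuts *)

Section decoding.
Context (R : realType).

(** The successor keeps coordinate 0 free for the event. *)
Definition code_index (k : bool * rat) : nat := (pickle k).+1.

(** Extended-real, because an arbitrary sequence may select no rational or arbitrarily large
    ones. *)
Definition decode (i : bool) (b : binseq) : \bar R :=
  ereal_sup [set (ratr q)%:E | q in [set q | b (code_index (i, q))]].

Lemma measurable_decode i : measurable_fun setT (decode i).
Proof.
apply: (measurability _ (ErealGenOInfty.measurableE R)) => // _ [_ [x ->] <-].
rewrite setTI (_ : _ @^-1` _ = \bigcup_(q : rat)
    (if x < ratr q then [set b : nat -> bool | b (code_index (i, q))]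
     else set0)).
  apply: (@countable_bigcupT_measurable _ binseq) => // q.
  by case: ifP => // _; exact: measurable_coordinate.
apply/seteqP; split => b /=; rewrite in_itv/= andbT.
  move=> /ereal_sup_gt[_ [q bq <-]]; rewrite lte_fin => xq.
  by exists q => //; rewrite xq.
move=> [q _]; case: ifP => // xq bq.
apply: (@lt_le_trans _ _ (ratr q)%:E); first by rewrite lte_fin.
by apply: ereal_sup_ubound; exists q.
Qed.

Lemma ereal_sup_rat_lt (x : R) :
  ereal_sup [set (ratr q)%:E | q in [set q | ratr q < x]] = x%:E.
Proof.
apply/eqP; rewrite eq_le; apply/andP; split.
  by apply: ge_ereal_sup => _ [q /= qx <-]; rewrite lee_fin ltW.
rewrite leNgt; apply/negP => supx.
(* A real [y < x] above the supremum; the default [x - 1] serves when the supremum is [-oo]. *)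
pose y := if ereal_sup [set (ratr q)%:E | q in [set q | ratr q < x]] is r%:E
  then r else x - 1.
have [yx supy] : y < x /\
    (ereal_sup [set (ratr q)%:E | q in [set q | (ratr q < x)%R]] <= y%:E)%E.
  rewrite /y; move: supx; case: ereal_sup => [r||] //=.
  by move=> _; split; [rewrite gtrBl|exact: leNye].
have [q] := rat_in_itvoo yx; rewrite in_itv/= => /andP[yq qx].
have : ((ratr q)%:E <= y%:E)%E.
  by apply: le_trans supy; apply: ereal_sup_ubound; exists q.
by rewrite lee_fin leNgt yq.
Qed.

End decoding.

(** * Copying a tree of events onto another event of equal mass *)

Section transfer.
Context (d : measure_display) (T : measurableType d) (R : realType).
Variable P : probability T R.

Fixpoint code_tree (G : nat -> set T) (s : seq bool) : set T :=
  if s is x :: s' then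
    code_tree G s' `&` (if x then G (size s') else ~` G (size s'))
  else setT.

Lemma binary_tree_code G : (forall n, measurable (G n)) ->
  binary_tree (code_tree G).
Proof.
move=> mG s; split => //=.
- elim: s => //= x s IHs; apply: measurableI => //.
  by case: x => //; exact: measurableC.
- by rewrite setDE setCI setIUr setICr set0U.
Qed.

Lemma address_codeE G w n : (forall n, measurable (G n)) ->
  address (code_tree G) w n = `[< G n w >].
Proof.
move=> /binary_tree_code/(branch_mem w n) Cw.
apply: asbool_equiv_eq; split => /= [[_]|]; last split => //;
  by rewrite -[size _]/(size (branch _ _ _)) -rev_prefix_address size_rev_prefix.
Qed.

(** Built from the root down: inside each node already copied, [atomless_range] cuts out a child of
    the prescribed mass, and the other child gets the right mass by subtraction. Only the first cut
    is imposed, namely [A]. *)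
Lemma mirror_tree G A : atomless P -> (forall n, measurable (G n)) ->
  measurable A -> P A = P (G 0%N) ->
  exists C, [/\ binary_tree C, C [:: true] = A &
    forall s, P (C s) = P (code_tree G s)].
Proof.
move=> atl mG mA PA; have treeE := binary_tree_code mG.
have mE s : measurable (code_tree G s) by case: (treeE s).
(* The node travels with its word, which determines the mass to cut out. *)
have split_ex (Cs : set T * seq bool) : exists D,
    measurable Cs.1 -> P Cs.1 = P (code_tree G Cs.2) ->
    [/\ measurable D, D `<=` Cs.1, P D = P (code_tree G (true :: Cs.2)) &
        (Cs = (setT, [::]) -> D = A)].
  have [->|Csn] := pselect (Cs = (setT, [::])).
    by exists A => _ _; split => //=; rewrite setTI.
  case: Cs Csn => C s Csn /=.
  have [[mC PC]|nC] := pselect (measurable C /\ P C = P (code_tree G s)); last first.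
    by exists set0 => mC PC; exfalso; apply: nC.
  have [||D [mD DC PD]] := @atomless_range _ _ _ P C
    (fine (P (code_tree G (true :: s)))) atl mC.
  - exact: fine_ge0.
  - rewrite -probability_fineK// PC; apply: le_measure; rewrite ?inE//.
    exact: subIsetl.
  by exists D => _ _; split => //; rewrite PD -probability_fineK.
have [f fP] := choice split_ex.
pose C := fix C s := if s is x :: s' then
  (if x then f (C s', s') else C s' `\` f (C s', s')) else setT.
have CP s : measurable (C s) /\ P (C s) = P (code_tree G s).
  elim: s => //= x s [mC PC]; have [mf fC Pf _] := fP (C s, s) mC PC.
  have [_ _ Esub Ediff] := treeE s.
  case: x => //; split; first exact: measurableD.
  rewrite -[_ `&` ~` _]/(code_tree G (false :: s)) Ediff.
  rewrite [LHS]probability_fineK ?[RHS]probability_fineK; try exact: measurableD.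
  by rewrite !fine_probabilityD// PC Pf.
exists C; split.
- move=> s; have [mC PC] := CP s; have [mf fC Pf _] := fP (C s, s) mC PC.
  by split.
- by have [mC PC] := CP [::]; have [_ _ _] := fP (C [::], [::]) mC PC; exact.
- by move=> s; case: (CP s).
Qed.

(* The bits of [phi w] record the truth of [w \in B] and of all the rational
   cuts [q < X w], [q < Y w], so [B], [X] and [Y] can be read off [phi w]. *)
Lemma joint_transfer (X Y : {RV P >-> R}) A B : atomless P ->
  measurable A -> measurable B -> P A = P B ->
  exists (phi psi : {mfun T >-> binseq}) (f g : {mfun binseq >-> R})
    (H : set binseq),
  [/\ measurable H, phi @^-1` H = B /\ psi @^-1` H = A,
      forall w, X w = f (phi w), forall w, Y w = g (phi w) &
      forall S : set binseq, measurable S -> P (psi @^-1` S) = P (phi @^-1` S)].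
Proof.
move=> atl mA mB PAB.
pose XY (i : bool) : {RV P >-> R} := if i then X else Y.
pose G n := if n is n'.+1 then
    (if (unpickle n' : option (bool * rat)) is Some k
     then [set w | ratr k.2 < XY k.1 w] else set0) else B.
have mG n : measurable (G n).
  case: n => //= n; case: unpickle => // -[i q].
  rewrite (_ : [set w | _] = XY i @^-1` `]ratr q, +oo[).
    exact: measurable_funPTI.
  by apply/seteqP; split => w /=; rewrite in_itv/= andbT.
have [C [treeC CA PC]] := mirror_tree atl mG mA PAB.
have treeE := binary_tree_code mG.
pose phi : {mfun T >-> binseq} := HB.pack (address (code_tree G))
  (isMeasurableFun.Build _ _ _ _ (address (code_tree G))
    (measurable_address treeE)).
pose psi : {mfun T >-> binseq} := HB.pack (address C)
  (isMeasurableFun.Build _ _ _ _ (address C) (measurable_address treeC)).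
(* [fine] makes the decoders real-valued on all of [binseq]; this matters because [psi] may take
   values outside the range of [phi]. *)
have mdec i : measurable_fun setT (fine \o @decode R i).
  by apply: measurableT_comp; [exact: fine_measurable|exact: measurable_decode].
pose dec i : {mfun binseq >-> R} := HB.pack (fine \o @decode R i)
  (isMeasurableFun.Build _ _ _ _ (fine \o @decode R i) (mdec i)).
have decE i w : XY i w = dec i (phi w).
  rewrite /= /decode -[LHS]/(fine (XY i w)%:E) -ereal_sup_rat_lt.
  congr (fine (ereal_sup [set (ratr q)%:E | q in _])).
  apply/seteqP; split => q /=; rewrite address_codeE//= pickleK/=;
  by move/asboolP.
exists phi, psi, (dec true), (dec false), [set b : nat -> bool | b 0%N].
split.
- exact: measurable_coordinate.
- split; apply/seteqP; split => w /=; rewrite ?address_codeE//.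
  + by move/asboolP.
  + by move=> ?; apply/asboolP.
  + by rewrite /address/= CA => /asboolP.
  + by rewrite /address/= CA => ?; apply/asboolP.
- exact: (decE true).
- exact: (decE false).
- by move=> S mS; apply: address_law.
Qed.

End transfer.

(** * Transfer of tail events and joint laws *)

Section transfer_tail_events.
Context (d : measure_display) (T : measurableType d) (R : realType).
Variable P : probability T R.
Implicit Types (X Y Z : {RV P >-> R}).

Lemma tail_eventP X A : tail_event X A <->
  [/\ measurable A, (0 < P A < 1)%E &
    exists t, P.-negligible [set w | A w /\ X w < t \/ ~ A w /\ t < X w]].
Proof.
split=> [[mA PA [N nN XN]]|[mA PA [t nt]]]; split => //; last first.
  exists [set w | A w /\ X w < t \/ ~ A w /\ t < X w] => // w w' [Aw Nw] [Aw' Nw'].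
  apply: (@le_trans _ _ t); rewrite leNgt; apply/negP => Xt.
    by apply: Nw'; right.
  by apply: Nw; left.
case: nN => M [mM PM NM].
(* Both [A] and its complement have points off [N], so the supremum is over a nonempty set bounded
   above. *)
have nonempty B : measurable B -> (0 < P B)%E -> exists w, (B `\` N) w.
  move=> mB PB; apply: contrapT => nB.
  have BM : B `<=` M.
    by move=> w Bw; apply: NM; apply: contrapT => Nw; apply: nB; exists w.
  have : (P B <= P M)%E by apply: le_measure; rewrite ?inE.
  by rewrite PM leNgt PB.
have /andP[PA0 PA1] := PA.
have [w1 w1P] := nonempty _ mA PA0.
have [|w0 w0P] := nonempty (~` A) (measurableC mA).
  by rewrite probability_setC// sube_gt0.
pose S := [set X w | w in ~` A `\` N].
have supS : has_sup S.
  by split; [exists (X w0), w0|exists (X w1) => _ [w wP <-]; exact: XN].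
exists (sup S); exists M; split => // w wP; apply: NM; apply: contrapT => Nw.
case: wP => -[Aw]; apply/negP; rewrite -leNgt.
  by apply: ge_sup; [exact: supS.1|move=> _ [w' w'P <-]; exact: XN].
by apply: ub_le_sup; [exact: supS.2|exists w].
Qed.

Lemma eq_law_sym X Y : eq_law X Y -> eq_law Y X.
Proof. by move=> XY B mB; rewrite XY. Qed.

Lemma eq_law_trans Y X Z : eq_law X Y -> eq_law Y Z -> eq_law X Z.
Proof. by move=> XY YZ B mB; rewrite XY// YZ. Qed.

(** In threshold form, the exceptional events are the preimages under [phi] and [psi] of one
    measurable set [S] of sequences, hence have equal mass. *)
Lemma tail_event_transfer (phi psi : {mfun T >-> binseq}) (H : set binseq)
    (f : {mfun binseq >-> R}) X X' : measurable H ->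
  (forall S : set binseq, measurable S -> P (psi @^-1` S) = P (phi @^-1` S)) ->
  (forall w, X w = f (phi w)) -> (forall w, X' w = f (psi w)) ->
  tail_event X (phi @^-1` H) -> tail_event X' (psi @^-1` H).
Proof.
move=> mH law Xf X'f /tail_eventP[mA PA [t nt]]; apply/tail_eventP; split.
- by rewrite -[X in measurable X]setTI; exact: measurable_funP.
- by rewrite law.
pose S := (H `&` f @^-1` `]-oo, t[) `|` (~` H `&` f @^-1` `]t, +oo[).
have mS : measurable S.
  apply: measurableU; apply: measurableI; rewrite ?setTI//;
    by [exact: measurable_funPTI|exact: measurableC].
have SE (th : {mfun T >-> binseq}) Z : (forall w, Z w = f (th w)) ->
    [set w | (th @^-1` H) w /\ Z w < t \/ ~ (th @^-1` H) w /\ t < Z w]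
    = th @^-1` S.
  by move=> Zf; apply/seteqP; split => w; rewrite /S/= Zf !in_itv/= andbT.
exists t; rewrite (SE _ _ X'f); apply/negligibleP; first exact: measurable_funPTI.
apply: (etrans (law S mS)); apply/negligibleP; first exact: measurable_funPTI.
by rewrite -(SE _ _ Xf).
Qed.

(** Both copies are decoded from the same [psi], so the pair keeps its joint law; decoding with
    [f + g] gives the law of the sum. *)
Lemma common_tail_event_transfer X Y A B : atomless P -> measurable A ->
  P A = P B -> tail_event X B -> tail_event Y B ->
  exists X' Y' : {RV P >-> R}, [/\ tail_event X' A, tail_event Y' A,
    eq_law X X', eq_law Y Y' & eq_law (P := P) (X + Y)%R (X' + Y')%R].
Proof.
move=> atl mA PAB tX tY; have [mB _ _] := tX.
have [phi [psi [f [g [H [mH [HB HA] Xf Yg law]]]]]] :=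
  joint_transfer X Y atl mA mB PAB.
pose X' : {RV P >-> R} := (f \o psi : {mfun T >-> R}).
pose Y' : {RV P >-> R} := (g \o psi : {mfun T >-> R}).
have eqlaw (h : {mfun binseq >-> R}) (Z Z' : {RV P >-> R}) :
    (forall w, Z w = h (phi w)) -> (forall w, Z' w = h (psi w)) -> eq_law Z Z'.
  move=> Zh Z'h B' mB'; rewrite /distribution/pushforward.
  rewrite (_ : Z @^-1` B' = phi @^-1` (h @^-1` B')); last first.
    by apply/seteqP; split => w /=; rewrite Zh.
  rewrite (_ : Z' @^-1` B' = psi @^-1` (h @^-1` B')); last first.
    by apply/seteqP; split => w /=; rewrite Z'h.
  by rewrite law//; exact: measurable_funPTI.
exists X', Y'; rewrite -HA; rewrite -HB in tX tY; split.
- exact: (tail_event_transfer (f := f) mH law Xf).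
- exact: (tail_event_transfer (f := g) mH law Yg).
- exact: (eqlaw f).
- exact: (eqlaw g).
- by apply: (eqlaw (f + g)%R) => // w; rewrite -[LHS]/(X w + Y w) Xf Yg.
Qed.

End transfer_tail_events.

(** * Sums and halves in convex cones *)

Section cones.
Context (d : measure_display) (T : measurableType d) (R : realType).
Variable P : probability T R.
Implicit Types calX : set {RV P >-> R}.

Lemma convex_cone_add calX X Y : convex_cone calX ->
  calX X -> calX Y -> calX (X + Y)%R.
Proof.
move=> coneX cX cY; have := coneX _ _ _ _ ltr01 ltr01 cX cY; congr calX.
by apply/mfuneqP => w /=; rewrite !mulr1.
Qed.

Lemma convex_cone_half calX X : convex_cone calX -> calX X ->
  exists X', [/\ calX X', forall w, X' w = X w / 2 & (X' + X')%R = X].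
Proof.
move=> coneX cX; have q0 : 0 < (4^-1 : R) by rewrite invr_gt0.
(* The half is taken as [X/4 + X/4], since the cone condition speaks of sums of two positive
   multiples. *)
eexists; split; first exact: (coneX _ _ _ _ q0 q0 cX cX).
  by move=> w /=; lra.
apply/mfuneqP => w.
rewrite -[LHS]/((X w * 4^-1 + X w * 4^-1) + (X w * 4^-1 + X w * 4^-1)).
by lra.
Qed.

Lemma eq_law_half (X Y X' Y' : {RV P >-> R}) : (forall w, X' w = X w / 2) ->
  (forall w, Y' w = Y w / 2) -> eq_law (P := P) X Y -> eq_law (P := P) X' Y'.
Proof.
move=> X'E Y'E XY B mB; rewrite /distribution/pushforward.
pose h x : R := x / 2.
have mh : measurable_fun setT h by exact: measurable_funM.
have E (Z Z' : {RV P >-> R}) : (forall w, Z' w = Z w / 2) ->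
    Z' @^-1` B = Z @^-1` (h @^-1` B).
  by move=> Z'E; apply/seteqP; split => w /=; rewrite Z'E.
rewrite (E _ _ X'E) (E _ _ Y'E); apply: XY.
by rewrite -[X in measurable X]setTI; exact: mh.
Qed.

End cones.

Theorem proposition1 (d : measure_display) (T : measurableType d)
    (R : realType) (P : probability T R)
    (calX : set {RV P >-> R}) (rho : {RV P >-> R} -> \bar R) :
  atomless P ->
  convex_cone calX ->
  law_closed calX ->
  risk_measure calX rho ->
  (law_invariance calX rho /\ concentration_aversion calX rho) <->
  (exists p : R, 0 < p < 1 /\ p_concentration_aversion p calX rho).
Proof.
move=> atl coneX closedX _; split.
  move=> [LI [A [mA PA CA]]].
  have /andP[PA0 PA1] := PA.
  (* This [p] makes the [p]-tail events have exactly the mass of [A]. *)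
  exists (1 - fine (P A)); split.
    rewrite (probability_fineK _ mA) !lte_fin in PA0 PA1.
    by rewrite subr_gt0 PA1/= gtrBl.
  move=> X Y X' Y' cX cY cX' cY' [B [[tX' PB] [tY' _]]] XX' YY'.
  have PAB : P A = P B by rewrite PB opprB addrC subrK -probability_fineK.
  have [X2 [Y2 [tX2 tY2 X'X2 Y'Y2 sum2]]] :=
    common_tail_event_transfer atl mA PAB tX' tY'.
  have cX2 := closedX _ _ X'X2 cX'; have cY2 := closedX _ _ Y'Y2 cY'.
  (* Law invariance moves the concentrated sum to the copy on [A], where concentration aversion
     applies. *)
  rewrite (LI (X' + Y')%R (X2 + Y2)%R) //; [|exact: convex_cone_add..].
  by apply: CA => //; [exact: eq_law_trans X'X2|exact: eq_law_trans Y'Y2].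
move=> [p [p01 pCA]]; split.
  move=> Z Z' cZ cZ' ZZ'.
  suff key U V : calX U -> calX V -> eq_law U V -> (rho U <= rho V)%E.
    by apply/eqP; rewrite eq_le !key//; exact: eq_law_sym.
  move=> cU cV UV.
  have [U' [cU' U'E <-]] := convex_cone_half coneX cU.
  have [V' [cV' V'E <-]] := convex_cone_half coneX cV.
  have U'V' := eq_law_half U'E V'E UV.
  (* The pair of equal halves [V'] shares this event, so it dominates the pair of halves [U']. *)
  have [A tA] := p_tail_event_exists V' atl p01.
  by apply: pCA => //; exists A.
have /andP[p0 p1] := p01.
(* Any event of mass [1 - p] can serve in concentration aversion: sharing it as a tail event is a
   case of [p]-concentration. *)
have [||A [mA _ PA]] := @atomless_range _ _ _ P setT (1 - p) atl measurableT.
- by rewrite subr_ge0 ltW.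
- by rewrite probability_setT lee_fin gerBl ltW.
exists A; split => //; first by rewrite PA !lte_fin; apply/andP; split; lra.
move=> X Y X' Y' cX cY cX' cY' XX' YY' tX' tY'.
by apply: pCA => //; exists A.
Qed.
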